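(* The formal power series $C_I$ and $C_S$ in the variables $x_1,x_2,\dots$ satisfy $$C_I(x_1,x_2,\dots)=\frac{1+x_1\,C_I(x_1x_2,\,x_2x_3,\,x_3x_4,\dots)}{1-x_1^2\,C_S(x_1^2x_2^2,\,x_2^2x_3^2,\,x_3^2x_4^2,\dots)}.$$
   Context: For a permutation $\pi$ and $k\geq1$, let $\sharp(1\text{-}2\text{-}\cdots\text{-}k)(\pi)$ be the number of increasing subsequences of length $k$ of $\pi$ (index sets $i_1<\dots<i_k$ with $\pi_{i_1}<\dots<\pi_{i_k}$; for $k=1$ this is the length of $\pi$). Let $\mathcal{S}(132)$ be the set of all permutations of all lengths (including the empty one) avoiding the pattern $132$ (no $i<j<k$ with $\pi_i<\pi_k<\pi_j$), and $\mathcal{I}(132)$ the subset of involutions ($\pi=\pi^{-1}$). Define $C_I(x_1,x_2,\dots)=\sum_{\pi\in\mathcal{I}(132)}\prod_{k\geq1}x_k^{\sharp(1\text{-}2\text{-}\cdots\text{-}k)(\pi)}$ and $C_S(x_1,x_2,\dots)=\sum_{\pi\in\mathcal{S}(132)}\prod_{k\geq1}x_k^{\sharp(1\text{-}2\text{-}\cdots\text{-}k)(\pi)}$. The notation $C(y_1,y_2,\dots)$ denotes substitution $x_k\mapsto y_k$. (It is known that $C_S(x_1,x_2,\dots)=1/(1-x_1C_S(x_1x_2,x_2x_3,\dots))$.) *)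

(* Defs.v *)
From HB Require Import structures.
From mathcomp Require Import all_boot all_order all_fingroup all_algebra.
From mathcomp Require Import finmap.
From mathcomp Require Import mathcomp_extra boolp classical_sets functions.
From mathcomp Require Import cardinality fsbigop.
From mathcomp.multinomials Require Import monalg.

Set Implicit Arguments.
Unset Strict Implicit.
Unset Printing Implicit Defensive.

Import GRing.Theory.

Section Permutations.
Local Open Scope set_scope.
Local Open Scope nat_scope.

(* An increasing subsequence of length k is encoded by its k positions. *)
Definition incr_count (k : nat) (n : nat) (s : 'S_n) : nat :=
  #|[set A : {set 'I_n} | (#|A| == k) &&
      [forall i in A, forall j in A, (i < j) ==> (s i < s j)]]|.

Lemma incr_count1 n (s : 'S_n) : incr_count 1 s = n.
Proof.
transitivity #|[set A : {set 'I_n} | A \subset [set: 'I_n] & #|A| == 1]|.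
  apply: eq_card => A; rewrite !inE finset.subsetT /=.
  case: cards1P => //= -[i ->]; apply/forall_inP => j; rewrite inE => /eqP ->.
  by apply/forall_inP => k; rewrite inE => /eqP ->; rewrite ltnn.
by rewrite cards_draws finset.cardsT card_ord bin1.
Qed.

Lemma incr_count_gt k n (s : 'S_n) : n < k -> incr_count k s = 0.
Proof.
move=> nk; apply/eqP; rewrite cards_eq0; apply/eqP/setP => A; rewrite !inE.
case: eqP => //= Ak; have := max_card (mem A).
by rewrite Ak card_ord leqNgt nk.
Qed.

Definition avoids132 n (s : 'S_n) : bool :=
  [forall i : 'I_n, forall j : 'I_n, forall k : 'I_n,
     ~~ [&& i < j, j < k, s i < s k & s k < s j]].

Definition is_involution n (s : 'S_n) : bool := s == (s^-1)%g.

End Permutations.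

Local Open Scope classical_set_scope.
Local Open Scope ring_scope.

(* Formal power series in possibly infinitely many variables indexed by I:
   arbitrary families of coefficients indexed by the monomials, i.e. by the
   finitely supported exponents. *)
Record mfps (I : choiceType) (R : Type) :=
  Mfps { mfps_coef :> {cmonom I} -> R }.

Section Divisors.
Context {I : choiceType}.
Implicit Types a b m : {cmonom I}.

Lemma cm_mulI a : injective (mmul a).
Proof.
move=> b c e; apply/eqP/cmP => i.
by move/eqP/cmP/(_ i): e; rewrite !cmM => /addnI.
Qed.

Lemma finite_cm_bounded m :
  finite_set [set d : {cmonom I} | forall i, (d i <= m i)%N].
Proof.
pose T := {ffun finsupp m -> 'I_(mdeg m).+1}.
pose h (g : T) : {cmonom I} := mkcmonom [fsfun i : finsupp m => val (g i) | 0%N].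
apply: (@sub_finite_set _ _ (range h)); last first.
  exact/finite_image/finite_finset.
move=> d /= dm.
have mle i : (m i <= mdeg m)%N.
  rewrite mdegE; case: mdomP => // im.
  by rewrite (big_fsetD1 i) //= leq_addr.
exists [ffun i : finsupp m => inord (d (val i))] => //.
apply/eqP/cmP => i; rewrite /h cmE /=.
have [im|im] := boolP (i \in finsupp m).
  rewrite fsfun_ffun insubT /= ffunE inordK // ltnS.
  exact: leq_trans (dm i) (mle i).
rewrite fsfun_ffun insubF /=; last exact: negbTE.
apply/esym/eqP; rewrite -leqn0.
by move: (dm i); rewrite (eqP (_ : m i == 0%N)) // cmE_eq0.
Qed.

Definition cm_divisors m : {fset {cmonom I}} :=
  fset_set [set d : {cmonom I} | forall i, (d i <= m i)%N].

Lemma cm_divisorsP (d m : {cmonom I}) : reflect (forall i, (d i <= m i)%N) (d \in cm_divisors m).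
Proof.
rewrite in_fset_set; last exact: finite_cm_bounded.
by apply: (iffP idP) => [|h]; [rewrite inE | rewrite inE].
Qed.

Lemma cm_divisors_mull a b m : mmul a b = m -> a \in cm_divisors m.
Proof. by move=> <-; apply/cm_divisorsP => i; rewrite cmM leq_addr. Qed.

Lemma cm_divisors_mulr a b m : mmul a b = m -> b \in cm_divisors m.
Proof. by rewrite mulmC; apply: cm_divisors_mull. Qed.

Lemma cm_divisors_trans a b m :
  a \in cm_divisors b -> b \in cm_divisors m -> a \in cm_divisors m.
Proof.
move=> /cm_divisorsP ab /cm_divisorsP bm; apply/cm_divisorsP => i.
exact: leq_trans (ab i) (bm i).
Qed.

End Divisors.

Section Series.
Context {I : choiceType} {R : comUnitRingType}.
Implicit Types (f g h : mfps I R) (m u : {cmonom I}).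

HB.instance Definition _ := [isNew for @mfps_coef I R].
HB.instance Definition _ := [Choice of mfps I R by <:].

Lemma mfpsP f g : (forall m, f m = g m) <-> f = g.
Proof.
by split=> [|-> //]; case: f g => [f] [g] /= fg; congr Mfps; apply/funext.
Qed.

Definition mfps0 : mfps I R := Mfps (fun=> 0).
Definition mfps_opp f : mfps I R := Mfps (fun m => - f m).
Definition mfps_add f g : mfps I R := Mfps (fun m => f m + g m).

Lemma mfps_addA : associative mfps_add.
Proof. by move=> f g h; apply/mfpsP => m /=; rewrite addrA. Qed.

Lemma mfps_addC : commutative mfps_add.
Proof. by move=> f g; apply/mfpsP => m /=; rewrite addrC. Qed.

Lemma mfps_add0 : left_id mfps0 mfps_add.
Proof. by move=> f; apply/mfpsP => m /=; rewrite add0r. Qed.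

Lemma mfps_addN : left_inverse mfps0 mfps_opp mfps_add.
Proof. by move=> f; apply/mfpsP => m /=; rewrite addNr. Qed.

HB.instance Definition _ := GRing.isZmodule.Build (mfps I R)
  mfps_addA mfps_addC mfps_add0 mfps_addN.

Definition monoX u : mfps I R := Mfps (fun m => (m == u)%:R).

Definition mfps1 : mfps I R := monoX mone.

Definition mfps_mul f g : mfps I R :=
  Mfps (fun m => \sum_(p \in [set p | mmul p.1 p.2 = m]) f p.1 * g p.2).

Lemma mfps_mulE (B : {fset {cmonom I}}) f g m :
    (forall d, d \in cm_divisors m -> d \in B) ->
  mfps_mul f g m =
  \sum_(a <- B) \sum_(b <- B) (if mmul a b == m then f a * g b else 0).
Proof.
move=> subB; rewrite /mfps_mul /= fsbig_mkcond.
rewrite (@fsbigE _ _ _ _ _ [seq (a, b) | a <- B, b <- B]) //; last first.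
- move=> [a b] _; rewrite /patch; case: ifP => //; rewrite inE /= => abm.
  move/negP; case; apply/allpairsP; exists (a, b); split => //=; apply: subB.
    exact: cm_divisors_mull abm.
  exact: cm_divisors_mulr abm.
- by apply: allpairs_uniq => // -[a b] [c d].
rewrite big_mkcond big_allpairs /=.
apply: eq_bigr => a _; apply: eq_bigr => b _.
rewrite in_setT /patch.
by congr (if _ then _ else _); apply/idP/eqP; rewrite inE.
Qed.

Lemma mfps_mulC : commutative mfps_mul.
Proof.
move=> f g; apply/mfpsP => m.
rewrite !(@mfps_mulE (cm_divisors m)) // exchange_big /=.
by apply: eq_bigr => a _; apply: eq_bigr => b _; rewrite mulmC mulrC.
Qed.

Lemma mfps_mul_trip f g h m : let B := cm_divisors m in
  mfps_mul f (mfps_mul g h) m =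
  \sum_(a <- B) \sum_(b <- B) \sum_(c <- B)
     (if mmul a (mmul b c) == m then f a * (g b * h c) else 0).
Proof.
move=> B; rewrite (@mfps_mulE B) //; apply: eq_bigr => a _.
transitivity (\sum_(u <- B) \sum_(b <- B) \sum_(c <- B)
  (if (mmul a u == m) && (mmul b c == u) then f a * (g b * h c) else 0)).
  rewrite big_seq [RHS]big_seq; apply: eq_bigr => u uB.
  case: ifP => _; last by rewrite big1 // => b _; rewrite big1.
  rewrite (@mfps_mulE B) => [|d du]; last exact: cm_divisors_trans du uB.
  rewrite mulr_sumr; apply: eq_bigr => b _.
  rewrite mulr_sumr; apply: eq_bigr => c _ /=.
  by case: ifP; rewrite ?mulr0.
rewrite exchange_big /=; apply: eq_bigr => b _.
rewrite exchange_big /=; apply: eq_bigr => c _.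
case: ifP => [/eqP e|ne].
  have uB : mmul b c \in B by exact: cm_divisors_mulr e.
  rewrite (big_rem _ uB) /= e !eqxx /= big_seq big1 ?addr0 // => u.
  rewrite mem_rem_uniq ?fset_uniq // inE => /andP[/negbTE un _].
  by rewrite [_ == u]eq_sym un andbF.
rewrite big1 // => u _; case: ifP => // /andP[/eqP e1 /eqP e2].
by rewrite e2 e1 eqxx in ne.
Qed.

Lemma mfps_mulA : associative mfps_mul.
Proof.
move=> f g h; apply/mfpsP => m.
rewrite [in RHS]mfps_mulC !mfps_mul_trip.
under eq_bigr do rewrite exchange_big /=.
rewrite exchange_big /=.
apply: eq_bigr => c _; apply: eq_bigr => a _; apply: eq_bigr => b _.
by rewrite mulmA mulmC [h c * _]mulrC mulrA.
Qed.

Lemma mfps_mulDl : left_distributive mfps_mul +%R.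
Proof.
move=> f g h; apply/mfpsP => m.
transitivity (mfps_mul f h m + mfps_mul g h m); last by [].
rewrite !(@mfps_mulE (cm_divisors m)) // -big_split /=.
apply: eq_bigr => a _; rewrite -big_split /=; apply: eq_bigr => b _.
by case: ifP; rewrite ?addr0 // mulrDl.
Qed.

Lemma mfps_mul1 : left_id mfps1 mfps_mul.
Proof.
move=> f; apply/mfpsP => m.
rewrite /mfps_mul /= -(@fsbig_widen _ _ _ _ [set (mone, m)]).
- by rewrite fsbig_set1 /mfps1 /monoX eqxx mul1r.
- by move=> _ ->; rewrite /= mul1m.
move=> [a b] [/= abm ne]; rewrite /mfps1 /monoX; case: eqP => [a1|_].
  by case: ne; rewrite -abm a1 mul1m.
by rewrite mul0r.
Qed.

Lemma mfps_oner_neq0 : mfps1 != 0.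
Proof.
apply/eqP => /(congr1 (fun f : mfps I R => f mone)); rewrite /mfps1 /monoX /= eqxx.
by move/eqP; rewrite oner_eq0.
Qed.

HB.instance Definition _ := GRing.Zmodule_isComNzRing.Build (mfps I R)
  mfps_mulA mfps_mulC mfps_mul1 mfps_mulDl mfps_oner_neq0.

Lemma mfps1E m : (1 : mfps I R) m = (m == mone)%:R. Proof. by []. Qed.

Lemma mfpsDE f g m : (f + g) m = f m + g m. Proof. by []. Qed.

Lemma mfpsNE f m : (- f) m = - f m. Proof. by []. Qed.

Lemma mfpsBE f g m : (f - g) m = f m - g m. Proof. by []. Qed.

Lemma mfpsME f g m :
  (f * g) m = \sum_(p \in [set p | mmul p.1 p.2 = m]) f p.1 * g p.2.
Proof. by []. Qed.

Lemma mfpsME_seq (B : {fset {cmonom I}}) f g m :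
    (forall d, d \in cm_divisors m -> d \in B) ->
  (f * g) m = \sum_(a <- B) \sum_(b <- B) (if mmul a b == m then f a * g b else 0).
Proof. exact: mfps_mulE. Qed.

Lemma mfpsM1E f g : (f * g) mone = f mone * g mone.
Proof.
rewrite mfpsME [X in \sum_(p \in X) _](_ : _ = [set (mone, mone)]).
  by rewrite fsbig_set1.
apply/seteqP; split => [[a b] /= /unitm[-> ->] //|_ ->] /=.
exact: mul1m.
Qed.

Lemma mfps_exp_lt h n m : h mone = 0 -> (mdeg m < n)%N -> (h ^+ n) m = 0.
Proof.
move=> h1; elim: n m => // n IHn m dm.
rewrite exprS (mfpsME_seq (B := cm_divisors m)) //.
rewrite big1 // => a _; rewrite big1 // => b _; case: eqP => // abm.
have [->|a1] := eqVneq a mone; first by rewrite h1 mul0r.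
rewrite IHn ?mulr0 // -ltnS (leq_trans _ dm) // ltnS -abm mdegM.
by rewrite -[X in (X < _)%N]add0n ltn_add2r lt0n mdeg_eq0.
Qed.

Lemma mfps_geom h : h mone = 0 -> exists g, g * (1 - h) = 1.
Proof.
move=> h1; pose G n := \sum_(i < n) h ^+ i.
have Gst n m : (mdeg m < n)%N -> G n m = G (mdeg m).+1 m.
  move=> /subnKC <-; elim: (n - _)%N => [|k IHk]; first by rewrite addn0.
  rewrite addnS /G big_ord_recr mfpsDE -/(G _) IHk mfps_exp_lt ?addr0 //.
  by rewrite addSn ltnS leq_addr.
exists (Mfps (fun m => G (mdeg m).+1 m)); apply/mfpsP => m.
transitivity ((G (mdeg m).+1 * (1 - h)) m).
  rewrite !(mfpsME_seq (B := cm_divisors m)) //.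
  apply: eq_bigr => a _; apply: eq_bigr => b _; case: eqP => // abm.
  by congr (_ * _); rewrite [RHS]Gst // ltnS -abm mdegM leq_addr.
rewrite mulrC -opprB mulNr -subrX1 opprB mfpsBE mfps_exp_lt ?subr0 //.
Qed.

(* A series is invertible exactly when its constant coefficient is; the
   inverse of a non-unit is itself, as usual. *)
Definition mfps_unit : pred (mfps I R) := fun f => f mone \is a GRing.unit.

Lemma mfps_unit_inv f : mfps_unit f -> exists g, g * f = 1.
Proof.
rewrite /mfps_unit => fu.
pose c (r : R) : mfps I R := Mfps (fun m => if m == mone then r else 0).
pose h := 1 - c (f mone)^-1 * f.
have h1 : h mone = 0 by rewrite /h mfpsBE mfpsM1E mfps1E /= eqxx mulVr ?subrr.
have [g] := mfps_geom h1; rewrite /h subKr mulrA => e.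
by exists (g * c (f mone)^-1).
Qed.

Definition mfps_inv f : mfps I R :=
  match pselect (mfps_unit f) with
  | left fu => projT1 (cid (mfps_unit_inv fu))
  | right _ => f
  end.

Lemma mfps_mulVf : {in mfps_unit, left_inverse 1 mfps_inv *%R}.
Proof.
move=> f fu; rewrite /mfps_inv; case: pselect => [fu'|//].
by case: cid.
Qed.

Lemma mfps_unitP f g : g * f = 1 -> mfps_unit f.
Proof.
move=> /(congr1 (fun f : mfps I R => f mone)); rewrite mfpsM1E mfps1E eqxx => e.
by apply/unitrPr; exists (g mone); rewrite mulrC.
Qed.

Lemma mfps_inv_out : {in [predC mfps_unit], mfps_inv =1 id}.
Proof.
by move=> f fu; rewrite /mfps_inv; case: pselect => // fu'; rewrite inE in fu; case/negP: fu.
Qed.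

HB.instance Definition _ := GRing.ComNzRing_hasMulInverse.Build (mfps I R)
  mfps_mulVf mfps_unitP mfps_inv_out.

Lemma unit_mfpsE f : (f \is a GRing.unit) = (f mone \is a GRing.unit).
Proof. by []. Qed.

Lemma monoX1 : monoX mone = 1. Proof. by []. Qed.

Lemma monoXM u v : monoX (mmul u v) = monoX u * monoX v.
Proof.
apply/mfpsP => m; rewrite mfpsME /monoX /=.
rewrite fsbig_mkcond -(@fsbig_widen _ _ _ _ [set (u, v)]) //.
  rewrite fsbig_set1 /patch /= !eqxx mulr1.
  case: ifPn; first by rewrite inE /= => ->; rewrite eqxx.
  by rewrite notin_setE /= eq_sym => /eqP/negbTE ->.
move=> [a b] [_ /= ne]; rewrite /patch /=; case: ifP => // _.
case: eqP => [au|_]; last by rewrite mul0r.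
by case: eqP => [bv|_]; rewrite ?mulr0 //; case: ne; rewrite au bv.
Qed.

Lemma expcmnS u n : expcmn u n.+1 = mmul u (expcmn u n).
Proof.
rewrite /expcmn iteropS; case: n => [|n]; first by rewrite mulm1.
by rewrite iteropS.
Qed.

Lemma expcmnE u n i : expcmn u n i = (n * u i)%N.
Proof.
elim: n => [|n IHn]; first by rewrite cm1.
by rewrite expcmnS cmM IHn mulSn.
Qed.

Lemma monoX_exp u n : monoX u ^+ n = monoX (expcmn u n).
Proof.
elim: n => [|n IHn]; first by rewrite expr0.
by rewrite exprS IHn -monoXM expcmnS.
Qed.

Lemma monoX_prod (T : Type) (r : seq T) (u : T -> {cmonom I}) :
  \prod_(t <- r) monoX (u t) = monoX (\big[mmul/mone]_(t <- r) u t).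
Proof. by rewrite (big_morph _ monoXM monoX1). Qed.

Lemma unit_1subM f g : f mone = 0 -> 1 - f * g \is a GRing.unit.
Proof.
by move=> f0; rewrite unit_mfpsE mfpsBE mfpsM1E f0 mul0r subr0 mfps1E eqxx unitr1.
Qed.

Definition varX (i : I) : mfps I R := monoX (ucm i).

(* Coefficientwise sum of a family of series. Each coefficient is meaningful
   when all but finitely many terms contribute 0 to it (see perm_weight_summable). *)
Definition mfps_sum (T : choiceType) (A : set T) (F : T -> mfps I R) : mfps I R :=
  Mfps (fun m => \sum_(t \in A) F t m).

End Series.

(* f(y_i, i \in I) = sum over monomials m of f_m * prod_i y_i ^ m_i, computed
   coefficientwise (see mfps_subst_summable). *)
Definition mfps_subst (I J : choiceType) (R : comUnitRingType)
    (f : mfps I R) (y : I -> mfps J R) : mfps J R :=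
  Mfps (fun n => \sum_(m \in [set: {cmonom I}])
                   f m * (\prod_(i <- finsupp m) y i ^+ m i) n).

Lemma mfps_subst_summable (I : choiceType) (R : comUnitRingType)
    (f : mfps I R) (y : I -> mfps I R) (u : I -> {cmonom I}) (n : {cmonom I}) :
    (forall i, y i = monoX (u i)) -> (forall i, (0 < u i i)%N) ->
  finite_set [set m : {cmonom I} |
                f m * (\prod_(i <- finsupp m) y i ^+ m i) n != 0].
Proof.
move=> yE u_gt0; apply: sub_finite_set (finite_cm_bounded n) => m /=.
under eq_bigr do rewrite yE monoX_exp.
rewrite monoX_prod /=; case: (n =P _) => [-> _ i|_]; last first.
  by rewrite mulr0 eqxx.
case: mdomP => // im; rewrite (big_fsetD1 i) //= cmM expcmnE.
by rewrite (leq_trans _ (leq_addr _ _)) // leq_pmulr.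
Qed.

Definition allperm := {n : nat & 'S_n}.

Definition S132 : set allperm := [set p | avoids132 (tagged p)].

Definition I132 : set allperm := S132 `&` [set p | is_involution (tagged p)].

(* The variables are indexed from 0: varX k is x_{k+1}. The factors with
   k >= tag p are trivial, by incr_count_gt. *)
Definition perm_weight (p : allperm) : mfps nat int :=
  \prod_(k < tag p) varX (k : nat) ^+ incr_count k.+1 (tagged p).

Lemma perm_weight_summable (m : {cmonom nat}) :
  finite_set [set p : allperm | perm_weight p m != 0].
Proof.
apply: (@sub_finite_set _ _
  (\bigcup_(n in `I_(m 0).+1) range (fun s : 'S_n => Tagged (fun n => 'S_n) s : allperm))); last first.
  by apply: bigcup_finite => [|n _]; [exact: finite_II | exact/finite_image/finite_finset].
move=> [n s] /=; rewrite /perm_weight /=.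
under eq_bigr do rewrite monoX_exp.
rewrite monoX_prod /=; case: (m =P _) => // mE _.
exists n; last by exists s.
rewrite /= ltnS mE; case: n s {mE} => // n s.
by rewrite big_ord_recl cmM expcmnE cmUU muln1 incr_count1 leq_addr.
Qed.

Definition C_S : mfps nat int := mfps_sum S132 perm_weight.

Definition C_I : mfps nat int := mfps_sum I132 perm_weight.

(* Main.v *)
(* Split a 132-avoiding involution [s] at its maximum: every entry before the
   maximum exceeds every entry after it. If the maximum comes last, it is a fixed
   point and removing it leaves an arbitrary 132-avoiding involution. Otherwise,
   [s] being its own inverse, the block ending at the maximum is exchanged
   with the last block of the same length, so [s] is the layered word [u s' u^-1],
   with values decreasing from layer to layer, where [u] is a 132-avoiding permutation
   ending with its maximum and [s'] is an arbitrary 132-avoiding involution.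
   Increasing subsequences stay inside one of the three layers, [u] and [u^-1]
   have equally many of them, and appending a maximum to [t] turns each count of
   length-[k] ones into the sum of those of lengths [k] and [k-1] for [t], that is
   [x_k |-> x_k x_{k+1}] together with one factor [x_1]. *)
Require Import Defs.
From mathcomp Require Import boolp classical_sets functions cardinality fsbigop.
From mathcomp Require Import all_boot all_fingroup all_algebra finmap.
From mathcomp Require Import zify.
From mathcomp.multinomials Require Import monalg.
Set Implicit Arguments.
Unset Strict Implicit.
Unset Printing Implicit Defensive.

Import GRing.Theory.

(** * Counting cliques of a relation on a finite type *)

Section Cliques.
Local Open Scope nat_scope.

(** The condition includes [x = y], so a vertex of a clique must be related to itself; the relation
    [agree] used later is reflexive. *)
Definition clique_set (T : finType) (r : rel T) (k : nat) : {set {set T}} :=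
  [set A : {set T} | (#|A| == k) && [forall x in A, forall y in A, r x y]].

Lemma clique_setP (T : finType) (r : rel T) k (A : {set T}) :
  reflect (#|A| = k /\ {in A &, forall x y, r x y}) (A \in clique_set r k).
Proof.
rewrite inE; apply: (iffP andP) => [[/eqP ? h]|[/eqP ? h]]; split=> //.
  by move=> x y xA yA; exact: (forall_inP (forall_inP h x xA)).
by apply/forall_inP => x xA; apply/forall_inP => y yA; exact: h.
Qed.

Lemma card_clique_bij (T T' : finType) (r : rel T) (r' : rel T') (h : T -> T') k :
    bijective h -> (forall x y, r' (h x) (h y) = r x y) ->
  #|clique_set r' k| = #|clique_set r k|.
Proof.
move=> hbij rh; have hinj := bij_inj hbij.
rewrite -(card_imset _ (imset_inj hinj)); apply: eq_card => B.
apply/idP/imsetP => [/clique_setP[Bk rB]|[A /clique_setP[Ak rA] ->]].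
  have hB : h @: (h @^-1: B) = B.
    case: hbij => g gh hg; apply/setP => y; apply/imsetP/idP.
      by case=> x; rewrite inE => ? ->.
    by move=> yB; exists (g y); rewrite ?inE hg.
  exists (h @^-1: B) => //; apply/clique_setP; split.
    by rewrite -[LHS](card_imset _ hinj) hB.
  by move=> x y; rewrite !inE -rh; apply: rB.
apply/clique_setP; split; first by rewrite card_imset.
by move=> _ _ /imsetP[x xA ->] /imsetP[y yA ->]; rewrite rh; apply: rA.
Qed.

Lemma eq_card_clique (T : finType) (r r' : rel T) k :
  r =2 r' -> #|clique_set r k| = #|clique_set r' k|.
Proof. by move=> e; apply: (card_clique_bij (h := id)) => //; exists id. Qed.

(** A clique that meets one summand cannot leave it. The size is [k.+1] because the empty clique
    would be counted once on each side. *)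
Lemma card_clique_sum (T1 T2 : finType) (r : rel (T1 + T2)) k :
    (forall x y, ~~ r (inl x) (inr y)) -> (forall x y, ~~ r (inr x) (inl y)) ->
  #|clique_set r k.+1| =
  #|clique_set (fun x y => r (inl x) (inl y)) k.+1|
  + #|clique_set (fun x y => r (inr x) (inr y)) k.+1|.
Proof.
move=> r12 r21.
have i1 : injective (@inl T1 T2) by move=> ? ? [].
have i2 : injective (@inr T1 T2) by move=> ? ? [].
rewrite -(card_imset _ (imset_inj i1)) -(card_imset (clique_set _ _) (imset_inj i2)).
rewrite -cardsUI; set Z := _ :&: _.
rewrite (_ : Z = set0) ?cards0 ?addn0; last first.
  apply/setP => A; rewrite !inE; apply/andP => -[/imsetP[A1 /clique_setP[A1k _] ->]].
  case/imsetP => A2 _; have /card_gt0P[x xA1] : 0 < #|A1| by rewrite A1k.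
  by move/setP/(_ (inl x)); rewrite imset_f // => /esym/imsetP[].
apply: eq_card => A; rewrite in_setU.
apply/clique_setP/orP => [[Ak rA]|[]/imsetP[B /clique_setP[Bk rB] ->]]; last first.
- split; first by rewrite card_imset.
  by move=> _ _ /imsetP[x xB ->] /imsetP[y yB ->]; apply: rB.
- split; first by rewrite card_imset.
  by move=> _ _ /imsetP[x xB ->] /imsetP[y yB ->]; apply: rB.
have /card_gt0P[[x xA|x xA]] : 0 < #|A| by rewrite Ak.
- have AE : inl @: (inl @^-1: A) = A.
    apply/setP => -[y|y]; first by rewrite mem_imset // inE.
    rewrite (_ : (_ \in A) = false); first by apply/imsetP => -[].
    by apply/negP => yA; move: (rA _ _ xA yA); rewrite (negbTE (r12 _ _)).
  left; rewrite -AE imset_f //; apply/clique_setP; split.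
    by rewrite -(card_imset _ i1) AE.
  by move=> y z; rewrite !inE; apply: rA.
- have AE : inr @: (inr @^-1: A) = A.
    apply/setP => -[y|y]; last by rewrite mem_imset // inE.
    rewrite (_ : (_ \in A) = false); first by apply/imsetP => -[].
    by apply/negP => yA; move: (rA _ _ xA yA); rewrite (negbTE (r21 _ _)).
  right; rewrite -AE imset_f //; apply/clique_setP; split.
    by rewrite -(card_imset _ i2) AE.
  by move=> y z; rewrite !inE; apply: rA.
Qed.

(** The first term counts the cliques omitting [None]; the others arise by adding [None], which is
    related to everything, to a clique with one vertex less. *)
Lemma card_clique_option (T : finType) (r : rel (option T)) k :
    (forall x, r None x) -> (forall x, r x None) ->
  #|clique_set r k.+1| =
  #|clique_set (fun x y => r (Some x) (Some y)) k.+1|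
  + #|clique_set (fun x y => r (Some x) (Some y)) k|.
Proof.
move=> rN Nr; pose F (B : {set T}) := None |: (Some @: B).
have iS : injective (@Some T) by move=> ? ? [].
have NS (B : {set T}) : (None \in Some @: B) = false by apply/imsetP => -[].
have FK : cancel F (fun A => Some @^-1: A).
  by move=> B; apply/setP => x; rewrite !inE /= mem_imset.
rewrite -(card_imset _ (imset_inj iS)) -(card_imset (clique_set _ k) (can_inj FK)).
rewrite -cardsUI; set Z := _ :&: _.
rewrite (_ : Z = set0) ?cards0 ?addn0; last first.
  apply/setP => A; rewrite !inE; apply/andP => -[/imsetP[A1 _ ->]].
  by case/imsetP => A2 _ /setP/(_ None); rewrite NS !inE.
apply: eq_card => A; rewrite in_setU.
apply/clique_setP/orP => [[Ak rA]|[]/imsetP[B /clique_setP[Bk rB] ->]]; last first.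
- split; first by rewrite cardsU1 NS card_imset ?Bk.
  move=> x y; rewrite !inE => /orP[/eqP -> //|/imsetP[x' xB ->]].
  by move=> /orP[/eqP -> //|/imsetP[y' yB ->]]; apply: rB.
- split; first by rewrite card_imset.
  by move=> _ _ /imsetP[x xB ->] /imsetP[y yB ->]; apply: rB.
have rS : {in Some @^-1: A &, forall x y, r (Some x) (Some y)}.
  by move=> x y; rewrite !inE; apply: rA.
have [NA|NA] := boolP (None \in A); [right|left].
  have AE : F (Some @^-1: A) = A.
    by apply/setP => -[x|]; rewrite !inE /= ?NA // mem_imset // inE.
  rewrite -AE imset_f //; apply/clique_setP; split=> //.
  by apply/eqP; rewrite -eqSS -Ak -[in X in _ == X]AE cardsU1 NS card_imset.
have AE : Some @: (Some @^-1: A) = A.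
  by apply/setP => -[x|]; rewrite ?NS ?(negbTE NA) // mem_imset // inE.
rewrite -AE imset_f //; apply/clique_setP; split=> //.
by rewrite -Ak -[in RHS]AE card_imset.
Qed.

End Cliques.

(** * Increasing subsequences and 132-avoidance under inversion, [grow] and [swap] *)

Section Permutations.
Local Open Scope nat_scope.

(* Increasing subsequences of [s] are the cliques of this symmetric relation,
   which is carried by [s] to the one of [s^-1]. *)
Definition agree n (s : 'S_n) : rel 'I_n := fun i j => (i < j) == (s i < s j).

(** Applied to a pair in both orders, the one-sided implication in [incr_count] becomes the
    equivalence in [agree]. *)
Lemma incr_countE k n (s : 'S_n) : incr_count k s = #|clique_set (agree s) k|.
Proof.
apply: eq_card => A; rewrite !inE; congr (_ && _).
apply/forall_inP/forall_inP => h i iA; apply/forall_inP => j jA; last first.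
  by apply/implyP => ij; rewrite -(eqP (forall_inP (h i iA) j jA)).
have hA x y (xA : x \in A) (yA : y \in A) := implyP (forall_inP (h x xA) y yA).
rewrite /agree; case: (ltngtP i j) => [ij|ji|/val_inj ->]; last by rewrite ltnn.
  by rewrite hA.
by rewrite ltnNge (ltnW (hA _ _ jA iA ji)).
Qed.

Lemma incr_count0 n (s : 'S_n) : incr_count 0 s = 1.
Proof.
rewrite incr_countE -(cards1 (set0 : {set 'I_n})); apply: eq_card => A.
rewrite !inE cards_eq0; case: eqP => //= ->.
by apply/forall_inP => x; rewrite inE.
Qed.

Lemma incr_countV k n (s : 'S_n) : incr_count k s^-1 = incr_count k s.
Proof.
rewrite !incr_countE; apply: (card_clique_bij (h := s)) => [|x y].
  by exists (s^-1)%g => x; rewrite ?permK ?permKV.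
by rewrite /agree !permK eq_sym.
Qed.

Lemma avoids132P n (s : 'S_n) :
  reflect (forall i j k : 'I_n, i < j -> j < k -> ~ (s i < s k < s j))
    (avoids132 s).
Proof.
apply: (iffP forallP) => [h i j k ij jk|h i].
  by move: (h i) => /forallP/(_ j)/forallP/(_ k); rewrite ij jk /= => /negP.
apply/forallP => j; apply/forallP => k; apply/negP => /and4P[ij jk ik kj].
by apply: (h i j k) => //; rewrite ik.
Qed.

(** The pattern 132 is its own inverse: exchanging positions and values turns an occurrence at [i],
    [j], [k] into one whose values are [i], [k], [j]. *)
Lemma avoids132V n (s : 'S_n) : avoids132 s^-1 = avoids132 s.
Proof.
suff h (t : 'S_n) : avoids132 t -> avoids132 t^-1.
  by apply/idP/idP => [/h|/h //]; rewrite invgK.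
move/avoids132P => ht; apply/avoids132P => i j k ij jk /andP[ik kj].
by apply: (ht _ _ _ ik kj); rewrite !permKV ij.
Qed.

Lemma is_involutionP n (s : 'S_n) : reflect (involutive s) (is_involution s).
Proof.
apply: (iffP eqP) => [e x|h]; first by rewrite {1}e permK.
by apply/permP => x; apply: (@perm_inj _ s); rewrite permKV h.
Qed.

Definition grow n (s : 'S_n) : 'S_n.+1 := lift_perm ord_max ord_max s.

Lemma grow_max n (s : 'S_n) : grow s ord_max = ord_max.
Proof. exact: lift_perm_id. Qed.

Lemma grow_lift n (s : 'S_n) i : grow s (lift ord_max i) = lift ord_max (s i).
Proof. exact: lift_perm_lift. Qed.

Lemma growV n (s : 'S_n) : ((grow s)^-1)%g = grow s^-1.
Proof. exact: lift_permV. Qed.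

Lemma grow_inj n : injective (@grow n).
Proof.
move=> s t e; apply/permP => i; apply: (@lift_inj _ ord_max).
by rewrite -!grow_lift e.
Qed.

Lemma grow_surj n (s : 'S_n.+1) : s ord_max = ord_max -> exists t, s = grow t.
Proof.
move=> sm.
have sl i : exists j, s (lift ord_max i) = lift ord_max j.
  case: (unliftP ord_max (s (lift ord_max i))) => [j ->|]; first by exists j.
  by rewrite -[X in _ = X]sm => /perm_inj/eqP; rewrite eq_sym (negbTE (neq_lift _ _)).
have [f fE] := choice sl.
have f_inj : injective f.
  by move=> i j e; apply: (@lift_inj _ ord_max); apply: (@perm_inj _ s); rewrite !fE e.
exists (perm f_inj); apply/permP => i.
by case: (unliftP ord_max i) => [j|] ->; rewrite ?grow_max // grow_lift permE fE.
Qed.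

Lemma involution_grow n (s : 'S_n) : is_involution (grow s) = is_involution s.
Proof. by rewrite /is_involution growV (inj_eq (@grow_inj n)). Qed.

(** The appended entry is both last and largest, whereas no letter of 132 is both, so it takes part
    in no occurrence. *)
Lemma avoids132_grow n (s : 'S_n) : avoids132 (grow s) = avoids132 s.
Proof.
apply/avoids132P/avoids132P => h i j k.
  move=> ij jk; have := h (lift ord_max i) (lift ord_max j) (lift ord_max k).
  by rewrite !grow_lift !lift_max; apply.
case: (unliftP ord_max i) => [i'|] ->; last by rewrite ltnNge leq_ord.
case: (unliftP ord_max j) => [j'|] ->; last first.
  by move=> _; rewrite ltnNge leq_ord.
case: (unliftP ord_max k) => [k'|] ->; rewrite ?grow_max !grow_lift !lift_max.
  exact: h.
by move=> _ _ /andP[_]; rewrite ltnNge ltnW.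
Qed.

(** The appended maximum agrees with every entry, so it plays the part of [None] in
    [card_clique_option]. *)
Lemma incr_count_grow k n (s : 'S_n) :
  incr_count k.+1 (grow s) = incr_count k.+1 s + incr_count k s.
Proof.
pose h (x : option 'I_n) := oapp (lift ord_max) ord_max x.
rewrite !incr_countE (card_clique_bij (h := h) (r := fun x y => agree (grow s) (h x) (h y))) //.
  rewrite card_clique_option.
  - by congr (_ + _); apply: eq_card_clique => i j; rewrite /agree !grow_lift !lift_max.
  - move=> [i|]; rewrite /agree /h /oapp ?ltnn //.
    by rewrite grow_max grow_lift !lift_max /= !ltnNge !(ltnW (ltn_ord _)).
  - move=> [i|]; rewrite /agree /h /oapp ?ltnn //.
    by rewrite grow_max grow_lift !lift_max /= !ltn_ord.
exists (unlift ord_max); first by move=> [i|] /=; rewrite ?liftK ?unlift_none.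
by move=> i; case: (unliftP ord_max i) => [j|] ->.
Qed.

(* One-line notation: [u] shifted above everything, then [s] in the middle,
   then [u^-1] below. *)
Definition swap_fun m n (u : 'S_m) (s : 'S_n) (i : 'I_(m + (n + m))) : 'I_(m + (n + m)) :=
  match split i with
  | inl a => rshift m (rshift n (u a))
  | inr b => match split b with
             | inl c => rshift m (lshift m (s c))
             | inr d => lshift (n + m) (u^-1%g d)
             end
  end.

Variant swap_spec m n (u : 'S_m) (s : 'S_n) : 'I_(m + (n + m)) -> 'I_(m + (n + m)) -> Type :=
| SwapFirst a : swap_spec u s (lshift (n + m) a) (rshift m (rshift n (u a)))
| SwapMid c : swap_spec u s (rshift m (lshift m c)) (rshift m (lshift m (s c)))
| SwapLast d : swap_spec u s (rshift m (rshift n d)) (lshift (n + m) (u^-1%g d)).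

Lemma swap_funP m n (u : 'S_m) (s : 'S_n) i : swap_spec u s i (swap_fun u s i).
Proof.
rewrite /swap_fun -{1}(splitK i); case: (split i) => [a|b] /=; first by constructor 1.
by rewrite -{1}(splitK b); case: (split b) => [c|d]; [constructor 2|constructor 3].
Qed.

Lemma swap_fun1 m n (u : 'S_m) (s : 'S_n) a :
  swap_fun u s (lshift (n + m) a) = rshift m (rshift n (u a)).
Proof. by rewrite /swap_fun (unsplitK (inl a)). Qed.

Lemma swap_fun2 m n (u : 'S_m) (s : 'S_n) c :
  swap_fun u s (rshift m (lshift m c)) = rshift m (lshift m (s c)).
Proof. by rewrite /swap_fun (unsplitK (inr _)) (unsplitK (inl _)). Qed.

Lemma swap_fun3 m n (u : 'S_m) (s : 'S_n) d :
  swap_fun u s (rshift m (rshift n d)) = lshift (n + m) (u^-1%g d).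
Proof. by rewrite /swap_fun (unsplitK (inr _)) (unsplitK (inr _)). Qed.

Lemma swap_fun_inj m n (u : 'S_m) (s : 'S_n) : injective (swap_fun u s).
Proof.
(* The outer blocks are exchanged by [u] and its inverse, so only the middle block has to be
   inverted. *)
apply: (can_inj (g := swap_fun u s^-1)) => i.
by case: (swap_funP u s i) => x; rewrite ?swap_fun1 ?swap_fun2 ?swap_fun3 ?permK ?permKV.
Qed.

Definition swap m n (u : 'S_m) (s : 'S_n) : 'S_(m + (n + m)) := perm (@swap_fun_inj m n u s).

Lemma swapP m n (u : 'S_m) (s : 'S_n) i : swap_spec u s i (swap u s i).
Proof. by rewrite permE; exact: swap_funP. Qed.

Lemma swap1 m n (u : 'S_m) (s : 'S_n) a :
  swap u s (lshift (n + m) a) = rshift m (rshift n (u a)).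
Proof. by rewrite permE swap_fun1. Qed.

Lemma swap2 m n (u : 'S_m) (s : 'S_n) c :
  swap u s (rshift m (lshift m c)) = rshift m (lshift m (s c)).
Proof. by rewrite permE swap_fun2. Qed.

Lemma swap3 m n (u : 'S_m) (s : 'S_n) d :
  swap u s (rshift m (rshift n d)) = lshift (n + m) (u^-1%g d).
Proof. by rewrite permE swap_fun3. Qed.

Lemma involution_swap m n (u : 'S_m) (s : 'S_n) :
  is_involution (swap u s) = is_involution s.
Proof.
apply/is_involutionP/is_involutionP => h i.
  by have := h (rshift m (lshift m i)); rewrite !swap2 => /rshift_inj/lshift_inj.
by case: (swapP u s i) => x; rewrite ?swap1 ?swap2 ?swap3 ?permK ?permKV // h.
Qed.

Lemma ltn_add_ordF a b (x : 'I_a) : (a + b < x) = false.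
Proof. by apply/negbTE; rewrite -leqNgt (leq_trans (ltnW (ltn_ord x))) ?leq_addr. Qed.

(** In an occurrence of 132 the first and third entries increase, hence lie in one layer, and the
    second, standing between them, lies there too. The layer of [u^-1] is handled by
    [avoids132V]. *)
Lemma avoids132_swap m n (u : 'S_m) (s : 'S_n) :
  avoids132 (swap u s) = avoids132 u && avoids132 s.
Proof.
apply/idP/andP => [/avoids132P h|[hu /avoids132P hs]].
  split; apply/avoids132P => i j k ij jk.
    have := h (lshift _ i) (lshift _ j) (lshift _ k) ij jk.
    by rewrite !swap1 /= !ltn_add2l.
  have := h (rshift m (lshift m i)) (rshift m (lshift m j)) (rshift m (lshift m k)).
  by rewrite !swap2 /= !ltn_add2l; apply.
have /avoids132P hu' : avoids132 u^-1 by rewrite avoids132V.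
move/avoids132P: hu => hu.
apply/avoids132P => i j k ij jk /andP[].
have := ltn_trans ij jk; move: ij jk.
case: (swapP u s i) => x; case: (swapP u s k) => z /=;
  rewrite ?ltn_add2l ?ltn_add_ordF //;
  case: (swapP u s j) => y /=; rewrite ?ltn_add2l ?ltn_add_ordF // => xy yz _ xz zy.
- by apply: (hu x y z) => //; rewrite xz.
- by apply: (hs x y z) => //; rewrite xz.
- by apply: (hu' x y z) => //; rewrite xz.
Qed.

(** Entries of different layers never agree, so [card_clique_sum] applies twice; the last layer is
    counted through [incr_countV]. *)
Lemma incr_count_swap k m n (u : 'S_m) (s : 'S_n) :
  incr_count k.+1 (swap u s) = incr_count k.+1 u + incr_count k.+1 s + incr_count k.+1 u.
Proof.
pose h (x : 'I_m + ('I_n + 'I_m)) : 'I_(m + (n + m)) :=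
  match x with
  | inl a => lshift (n + m) a
  | inr (inl c) => rshift m (lshift m c)
  | inr (inr d) => rshift m (rshift n d)
  end.
rewrite incr_countE.
rewrite (card_clique_bij (h := h) (r := fun x y => agree (swap u s) (h x) (h y))) //; last first.
  exists (fun i => match split i with inl a => inl a | inr b => inr (split b) end).
    move=> [a|[c|d]] /=; first by rewrite (unsplitK (inl a)).
      by rewrite (unsplitK (inr _)) (unsplitK (inl _)).
    by rewrite (unsplitK (inr _)) (unsplitK (inr _)).
  move=> i; rewrite -[RHS]splitK; case: (split i) => [a|b] //=.
  by rewrite -[in RHS](splitK b); case: (split b).
have lt_shift a b x (xa : x < a) : x < a + b by rewrite ltn_addr.
rewrite card_clique_sum; first last.
- move=> [c|d] a /=; rewrite /agree swap1 ?swap2 ?swap3 /=.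
    by rewrite ltn_add_ordF // ltn_add2l lt_shift.
  by rewrite ltn_add_ordF // (leq_trans (ltn_ord _)) // leq_addr.
- move=> a [c|d] /=; rewrite /agree swap1 ?swap2 ?swap3 /=.
    by rewrite lt_shift // ltn_add2l ltn_add_ordF.
  by rewrite lt_shift // ltn_add_ordF.
rewrite card_clique_sum; first last.
- move=> d c /=; rewrite /agree swap2 swap3 /=.
  by rewrite ltn_add2l ltn_add_ordF // lt_shift.
- move=> c d /=; rewrite /agree swap2 swap3 /=.
  by rewrite ltn_add2l lt_shift // ltn_add_ordF.
rewrite -[in RHS]addnA; congr (_ + _); last congr (_ + _).
- by rewrite incr_countE; apply: eq_card_clique => x y; rewrite /agree /= !swap1 /= !ltn_add2l.
- by rewrite incr_countE; apply: eq_card_clique => x y; rewrite /agree /= !swap2 /= !ltn_add2l.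
- rewrite -incr_countV incr_countE; apply: eq_card_clique => x y.
  by rewrite /agree /= !swap3 /= !ltn_add2l.
Qed.

End Permutations.

(** * Splitting a 132-avoiding involution at its maximum *)

Section Decomposition.
Local Open Scope nat_scope.

(** The first block takes exactly the top [m] values. Since [s] is its own inverse, the last block
    returns to the first by the inverse map, and the middle block has only its own values left. *)
Lemma swap_surj m n (s : 'S_(m + (n + m))) : involutive s ->
    (forall a : 'I_m, m + n <= s (lshift (n + m) a)) ->
  exists (u : 'S_m) (t : 'S_n), s = swap u t.
Proof.
move=> sK s_hi.
have s1 a : exists b, s (lshift _ a) = rshift m (rshift n b).
  have := s_hi a; rewrite -(splitK (s _)); case: (split _) => [b|b] /=.
    by rewrite leqNgt ltn_addr.
  rewrite leq_add2l -(splitK b); case: (split b) => [c|c] /=; last by exists c.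
  by rewrite leqNgt ltn_ord.
have [f fE] := choice s1.
have f_inj : injective f.
  by move=> a b e; apply: (@lshift_inj _ (n + m)); apply: (@perm_inj _ s); rewrite !fE e.
have s3 d : s (rshift m (rshift n d)) = lshift _ ((perm f_inj)^-1%g d).
  by apply: (@perm_inj _ s); rewrite sK fE -[f _]permE permKV.
have s2 c : exists c', s (rshift m (lshift m c)) = rshift m (lshift m c').
  case: (split_ordP (s (rshift m (lshift m c)))) => [a e|b e].
    by have := congr1 s e; rewrite sK fE => /rshift_inj/eqP; rewrite eq_lrshift.
  case: (split_ordP b) e => [c' -> ->|d -> e]; first by exists c'.
  by have := congr1 s e; rewrite sK s3 => /eqP; rewrite eq_rlshift.
have [g gE] := choice s2.
have g_inj : injective g.
  move=> a b e; apply: (@lshift_inj _ m); apply: (@rshift_inj m).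
  by apply: (@perm_inj _ s); rewrite !gE e.
exists (perm f_inj), (perm g_inj); apply/permP => i.
by case: (swapP (perm f_inj) (perm g_inj) i) => x; rewrite ?fE ?gE ?s3 ?permE.
Qed.

(* Let [j] be the position of the maximum, so that [s l = j] at the last position [l].
   By avoidance every value at a position [<= j] exceeds every value at a
   position [> j]; two counts then force the first block to map onto the last. *)
Lemma involution132_swap N (s : 'S_N) (l : 'I_N) :
    l.+1 = N -> s l != l -> is_involution s -> avoids132 s ->
  exists m n (t : 'S_m) (r : 'S_n),
    Tagged (fun k => 'S_k) s = Tagged (fun k => 'S_k) (swap (grow t) r).
Proof.
move=> lN sl /is_involutionP sK /avoids132P s132.
have [j jE] : exists j : nat, s l = j :> nat by exists (s l).
have [d dN] : exists d, N = j.+1 + d.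
  by exists (N - j.+1); rewrite subnKC // -jE.
subst N.
have l_max x : s x != l -> s x < l.
  by move=> sxl; rewrite ltn_neqAle sxl -ltnS lN ltn_ord.
have jl : j < l by have := l_max l sl; rewrite jE.
have above (a : 'I_j.+1) (k : 'I_d) : s (rshift _ k) < s (lshift _ a).
  (* The largest value [l] is taken only at position [j], in the first block. *)
  have sk : s (rshift j.+1 k) < l.
    apply: l_max; apply/eqP => /(congr1 s).
    by rewrite sK => /(congr1 val) /=; rewrite jE; lia.
  have [aj|aj] := eqVneq (val a) j.
    suff -> : lshift d a = s l by rewrite sK.
    by apply: val_inj; rewrite /= jE.
  (* Otherwise the positions [a], [j] and that of [k] carry values [s a < s k < l], an occurrence of
     132. *)
  rewrite ltnNge; apply/negP => le_s.
  apply: (s132 (lshift d a) (s l) (rshift j.+1 k)); rewrite /= ?jE.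
  - by rewrite ltn_neqAle aj -ltnS ltn_ord.
  - exact: leq_addr.
  rewrite sK sk andbT ltn_neqAle le_s andbT.
  by apply/eqP => /val_inj/perm_inj/eqP; rewrite eq_lrshift.
(* First count: the [d] later values are distinct and all below [s a]. *)
have s_hi (a : 'I_j.+1) : d <= s (lshift d a).
  pose f (k : 'I_d) := Ordinal (above a k).
  suff /leq_card : injective f by rewrite !card_ord.
  by move=> x y [] /val_inj/perm_inj/rshift_inj.
have [k lE] : exists k, l = rshift j.+1 k.
  case: (split_ordP l) => [a|k ->]; last by exists k.
  by move=> la; move: jl; rewrite la /= ltnNge -ltnS ltn_ord.
(* Second count: the last position lies in the second block and has value [j], so every value of the
   first block exceeds [j]; hence that block injects into the second. *)
have s_mv (a : 'I_j.+1) : exists b, s (lshift d a) = rshift j.+1 b.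
  case: (split_ordP (s (lshift d a))) => [b e|b ->]; last by exists b.
  by have := above a k; rewrite -lE jE e /= ltnNge -ltnS ltn_ord.
have [g gE] := choice s_mv.
have jd : j.+1 <= d.
  suff /leq_card : injective g by rewrite !card_ord.
  by move=> x y e; apply: (@lshift_inj _ d); apply: (@perm_inj _ s); rewrite !gE e.
have [n dE] : exists n, d = n + j.+1 by exists (d - j.+1); rewrite subnK.
subst d.
have [a|u [r sE]] := swap_surj sK; first by rewrite addnC; exact: s_hi.
(* The first block ends at position [j], where [s] reaches its maximum [l]. *)
have [t tE] : exists t, u = grow t.
  apply: grow_surj; apply: val_inj => /=.
  have : s (lshift (n + j.+1) ord_max) = l.
    by rewrite -[RHS]sK; congr (s _); apply: val_inj; rewrite /= jE.
  by rewrite sE swap1 => /(congr1 val) /=; lia.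
by exists j, n, t, r; rewrite sE tE.
Qed.

End Decomposition.

(** * The disjoint decomposition of [I132] over all lengths *)

Section Allperm.
Local Open Scope nat_scope.
Local Open Scope classical_set_scope.

Definition mkperm n (s : 'S_n) : allperm := Tagged (fun k => 'S_k) s.

Lemma mkperm_inj n : injective (@mkperm n).
Proof. by move=> s t /eqP; rewrite -tag_eqE /tag_eq eqxx /= tagged_asE => /eqP. Qed.

Definition perm_nil : allperm := mkperm (1%g : 'S_0).
Definition perm_grow (p : allperm) : allperm := mkperm (grow (tagged p)).
Definition perm_swap (q : allperm * allperm) : allperm :=
  mkperm (swap (grow (tagged q.1)) (tagged q.2)).

Lemma perm_grow_inj : injective perm_grow.
Proof.
move=> [m s] [n t] /= e; have [mn] : m.+1 = n.+1 := congr1 tag e.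
by subst n; move/mkperm_inj/grow_inj: e => /= ->.
Qed.

(** This statistic recovers the size of the argument of [perm_grow] and of the first argument of
    [perm_swap], and tells the two images apart. Values start at 0, and the empty permutation gets
    the default 0. *)
Definition last_value (p : allperm) : nat :=
  match p with
  | existT n s => match n return 'S_n -> nat with
                  | 0 => fun=> 0
                  | k.+1 => fun s => s ord_max
                  end s
  end.

Lemma last_value_grow p : last_value (perm_grow p) = tag p.
Proof. by rewrite /= grow_max. Qed.

Lemma last_value_swap q : last_value (perm_swap q) = tag q.1.
Proof.
case: q => [[m s] [n t]].
rewrite -[LHS]/(nat_of_ord (swap (grow s) t (@ord_max (m + (n + m.+1))))).
have -> : @ord_max (m + (n + m.+1)) = rshift m.+1 (rshift n ord_max).
  by apply: (@val_inj _ _ 'I_(m.+1 + (n + m.+1))); rewrite /= addSn !addnS.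
by rewrite swap3 growV grow_max.
Qed.

(** The last value gives the size of the first component, the total length then gives that of the
    second, and both can be read off the blocks. *)
Lemma perm_swap_inj : injective perm_swap.
Proof.
move=> [[m s] [n t]] [[m' s'] [n' t']] e.
have mm : m = m' by have := congr1 last_value e; rewrite !last_value_swap.
subst m'; have nn : n = n' by have := congr1 tag e; rewrite /=; lia.
subst n'; move/mkperm_inj: e => /= e.
suff [/grow_inj -> ->] : grow s = grow s' /\ t = t' by [].
split; apply/permP => i.
  by apply/(@rshift_inj n)/(@rshift_inj m.+1); rewrite -(swap1 _ t) e swap1.
by apply/(@lshift_inj _ m.+1)/(@rshift_inj m.+1); rewrite -(swap2 (grow s)) e swap2.
Qed.

Lemma I132_decomp :
  I132 = [set perm_nil] `|` (perm_grow @` I132 `|` perm_swap @` (S132 `*` I132)).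
Proof.
apply/seteqP; split => [[[|n] s] [/= s132 si]|p].
- left => /=; congr (mkperm _); apply/permP => -[]//.
- right; have [sm|sm] := eqVneq (s ord_max) ord_max.
    have [t tE] := grow_surj sm; move: s132 si.
    rewrite tE /S132 /= avoids132_grow involution_grow => t132 ti.
    by left; exists (mkperm t).
  have [m [k [t [r e]]]] := involution132_swap (l := ord_max) erefl sm si s132.
  have e132 : S132 (mkperm (swap (grow t) r)) by rewrite /mkperm -e.
  have ei : is_involution (tagged (mkperm (swap (grow t) r))) by rewrite /mkperm -e.
  right; exists (mkperm t, mkperm r); last by rewrite -[LHS]e.
  move: e132 ei; rewrite /S132 /= avoids132_swap avoids132_grow involution_swap.
  by move=> /andP[? ?] ?; split.
case=> [->|[[q [q132 qi] <-]|[[q1 q2] [/= q1132 [q2132 q2i]] <-]]].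
- by split; [apply/avoids132P => -[]|apply/is_involutionP => -[]].
- by split; rewrite /S132 /= ?avoids132_grow ?involution_grow.
- split; rewrite /S132 /= ?avoids132_swap ?involution_swap ?avoids132_grow //.
  by apply/andP.
Qed.

Lemma perm_nil_notin : 
  [disjoint [set perm_nil] & perm_grow @` I132 `|` perm_swap @` (S132 `*` I132)].
Proof.
apply/disj_setPS => p [/= -> ] [] [q _ /(congr1 tag)] //.
Qed.

(** A permutation built by [perm_grow] ends with its maximum; one built by [perm_swap] ends with a
    value from the lowest layer. *)
Lemma grow_swap_disjoint (A : set allperm) (B : set (allperm * allperm)) :
  [disjoint perm_grow @` A & perm_swap @` B].
Proof.
apply/disj_setPS => p [/= [q _ <-] [[q1 q2] _ e]].
have := congr1 last_value e; rewrite last_value_swap last_value_grow.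
by have := congr1 tag e; rewrite /=; lia.
Qed.

End Allperm.

(** * Generating series of sets weighted by monomials *)

Section GenSeries.
Local Open Scope classical_set_scope.
Local Open Scope ring_scope.
Context {I : choiceType} {R : comUnitRingType}.
Implicit Types (m n u : {cmonom I}).

Definition gen_series (T : choiceType) (A : set T) (w : T -> {cmonom I}) : mfps I R :=
  mfps_sum A (fun t => monoX (w t)).

(** Summability is asked for all divisors of [m] at once, because the coefficient of a product at
    [m] involves the coefficients of the factors at divisors of [m]. *)
Definition finite_below (T : choiceType) (w : T -> {cmonom I}) : Prop :=
  forall m, finite_set [set t | w t \in cm_divisors m].

Definition below (T : choiceType) (A : set T) (w : T -> {cmonom I}) m : {fset T} :=
  fset_set (A `&` [set t | w t \in cm_divisors m]).

Lemma finite_below_le (T : choiceType) (w v : T -> {cmonom I}) :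
  (forall t i, (w t i <= v t i)%N) -> finite_below w -> finite_below v.
Proof.
move=> wv fw m; apply: sub_finite_set (fw m) => t /= /cm_divisorsP vm.
by apply/cm_divisorsP => i; exact: leq_trans (wv t i) (vm i).
Qed.

Lemma belowP (T : choiceType) (A : set T) w m t : finite_below w ->
  reflect (A t /\ w t \in cm_divisors m) (t \in below A w m).
Proof.
move=> fw; rewrite [t \in below _ _ _]in_fset_set; last exact/finite_setIr/fw.
by apply: (iffP idP) => [/set_mem//|]; exact: mem_set.
Qed.

Lemma cm_divisors_refl m : m \in cm_divisors m.
Proof. exact/cm_divisorsP. Qed.

(** The list may contain more than the objects of weight [m], so a single list can serve all
    divisors of a given monomial. *)
Lemma gen_series_seq (T : choiceType) (A : set T) w m (r : seq T) : uniq r ->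
    (forall t, t \in r -> A t) -> (forall t, A t -> w t = m -> t \in r) ->
  gen_series A w m = \sum_(t <- r) (m == w t)%:R.
Proof.
move=> r_uniq rA Ar; rewrite /gen_series /mfps_sum /= (@fsbigE _ _ _ _ _ r) //.
  rewrite big_seq_cond [RHS]big_seq; apply: eq_bigl => t.
  by case: (boolP (t \in r)) => //= /rA At; exact: mem_set.
move=> t At; case: (m =P w t) => // e; by rewrite Ar.
Qed.

Lemma gen_series_below (T : choiceType) (A : set T) w m n : finite_below w ->
  m \in cm_divisors n -> gen_series A w m = \sum_(t <- below A w n) (m == w t)%:R.
Proof.
move=> fw mn; apply: gen_series_seq => [|t|t At wt]; first exact: fset_uniq.
  by case/(belowP _ _ _ fw).
by apply/(belowP _ _ _ fw); rewrite wt.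
Qed.

(** After exchanging the sums, each [t] contributes only at [m = w t]. Both the product and the
    substitution rule reduce to this. *)
Lemma sum_gen_series (T : choiceType) (A : set T) w n (G : {cmonom I} -> R) :
    finite_below w ->
  \sum_(m <- cm_divisors n) gen_series A w m * G m = \sum_(t <- below A w n) G (w t).
Proof.
move=> fw.
transitivity (\sum_(m <- cm_divisors n) \sum_(t <- below A w n) (m == w t)%:R * G m).
  rewrite big_seq [RHS]big_seq; apply: eq_bigr => m mn.
  by rewrite (gen_series_below A fw mn) mulr_suml.
rewrite exchange_big /= big_seq [RHS]big_seq; apply: eq_bigr => t.
case/(belowP _ _ _ fw) => _ wn.
rewrite (bigD1_seq (w t)) ?fset_uniq //= eqxx mul1r big1 ?addr0 // => m.
by move=> /negbTE ->; rewrite mul0r.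
Qed.

Lemma gen_series_set1 (T : choiceType) (t : T) w : gen_series [set t] w = monoX (w t).
Proof. by apply/mfpsP => m; rewrite /gen_series /= fsbig_set1. Qed.

Lemma gen_series_image (S T : choiceType) (A : set S) (f : S -> T) w :
  injective f -> gen_series (f @` A) w = gen_series A (w \o f).
Proof.
move=> f_inj; apply/mfpsP => m; rewrite /gen_series /= fsbig_image //.
by move=> x y _ _; exact: f_inj.
Qed.

Lemma eq_gen_series (T : choiceType) (A : set T) w v :
  w =1 v -> gen_series A w = gen_series A v.
Proof. by move=> /funext ->. Qed.

Lemma gen_seriesU (T : choiceType) (A B : set T) w : finite_below w ->
  [disjoint A & B] -> gen_series (A `|` B) w = gen_series A w + gen_series B w.
Proof.
move=> fw /disj_set2P AB; apply/mfpsP => m; rewrite mfpsDE.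
have fin (X : set T) : finite_set (X `&` [set t | w t \in cm_divisors m]).
  exact/finite_setIr/fw.
(* The sets may be infinite, so each is first cut down to the finitely many objects whose weight
   divides [m]; the union is split only afterwards. *)
have widen (X : set T) :
    gen_series X w m = gen_series (X `&` [set t | w t \in cm_divisors m]) w m.
  rewrite /gen_series /= -(@fsbig_widen _ _ _ _ (X `&` [set t | w t \in cm_divisors m]) X) //.
  move=> t [Xt /= nXt]; case: eqP => // mw; case: nXt; split=> //=.
  by rewrite mw; exact: cm_divisors_refl.
rewrite (widen (A `|` B)) (widen A) (widen B) classical_sets.setIUl /gen_series /= fsbigU0 // => t [[At _] [Bt _]].
by rewrite -AB.
Qed.

Lemma gen_seriesM (S T : choiceType) (A : set S) (B : set T) w v :
    finite_below w -> finite_below v ->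
  gen_series A w * gen_series B v =
  gen_series (A `*` B) (fun q => mmul (w q.1) (v q.2)).
Proof.
move=> fw fv; apply/mfpsP => m; rewrite (mfpsME_seq (B := cm_divisors m)) //.
(* The condition on the product of monomials is moved into [G], so that [sum_gen_series] applies
   first to [A], then to [B]. *)
pose G a := \sum_(b <- cm_divisors m) gen_series B v b * (mmul a b == m)%:R.
transitivity (\sum_(a <- cm_divisors m) gen_series A w a * G a).
  apply: eq_bigr => a _; rewrite mulr_sumr; apply: eq_bigr => b _.
  by case: eqP => _; rewrite ?mulr1 ?mulr0.
rewrite sum_gen_series //.
rewrite (@gen_series_seq _ _ _ _ [seq (s, t) | s <- below A w m, t <- below B v m]).
- rewrite big_allpairs; apply: eq_bigr => s _; rewrite /G sum_gen_series //.
  by apply: eq_bigr => t _ /=; rewrite eq_sym.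
- by apply: allpairs_uniq => [||[? ?] [? ?]]; rewrite ?fset_uniq.
- move=> _ /allpairsP[[s t] /= [sA tB ->]].
  by split; [case/(belowP _ _ _ fw): sA|case/(belowP _ _ _ fv): tB].
move=> [s t] [/= As Bt] stm; apply/allpairsP; exists (s, t); split => //=.
  by apply/(belowP _ _ _ fw); split=> //; exact: cm_divisors_mull stm.
by apply/(belowP _ _ _ fv); split=> //; exact: cm_divisors_mulr stm.
Qed.

(** The monomial [u] is the series of a one-element set, which makes this a case of the product
    rule. *)
Lemma gen_series_shift (T : choiceType) (A : set T) u w : finite_below w ->
  gen_series A (fun t => mmul u (w t)) = monoX u * gen_series A w.
Proof.
move=> fw; have f1 : finite_below (fun _ : unit => u) by move=> m; exact: finite_finset.
rewrite -(gen_series_set1 tt (fun=> u)) gen_seriesM //.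
rewrite (_ : [set tt] `*` A = (fun t => (tt, t)) @` A).
  by rewrite gen_series_image // => ? ? [].
by apply/seteqP; split => [[[] t] [_ /= At]|_ [t At <-]]; [exists t|split].
Qed.

End GenSeries.

(** * Substituting monomials for the variables *)

Section Substitution.
Local Open Scope classical_set_scope.
Local Open Scope ring_scope.
Context {I : choiceType} {R : comUnitRingType}.
Implicit Types (m n : {cmonom I}) (u : I -> {cmonom I}).

Definition subst_monom u m : {cmonom I} :=
  \big[mmul/mone]_(i <- finsupp m) expcmn (u i) (m i).

Lemma subst_monomE u m k :
  subst_monom u m k = (\sum_(i <- finsupp m) m i * u i k)%N.
Proof.
rewrite /subst_monom (big_morph (fun x : {cmonom I} => x k) (cmM k) (cm1 k)).
by apply: eq_bigr => i _; rewrite expcmnE.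
Qed.

(** This puts an exponent in the form given by [subst_monomE], so that the two can be compared term
    by term. *)
Lemma finsupp_sum m k : (\sum_(i <- finsupp m) m i * (i == k) = m k)%N.
Proof.
have [km|km] := boolP (k \in finsupp m).
  rewrite (bigD1_seq k) ?fset_uniq //= eqxx muln1 big1 ?addn0 // => i.
  by move=> /negbTE ->; rewrite muln0.
rewrite big_seq big1 => [|i im].
  by apply/esym/eqP; rewrite cmE_eq0.
by rewrite (_ : (i == k) = false) ?muln0 //; apply: contraNF km => /eqP <-.
Qed.

(** Each variable divides its image, so exponents do not drop; this is what carries finiteness
    through a substitution. *)
Lemma leq_subst_monom u m k : (0 < u k k)%N -> (m k <= subst_monom u m k)%N.
Proof.
move=> uk; rewrite subst_monomE -{1}(finsupp_sum m k) leq_sum // => i _.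
by case: (eqVneq i k) => [->|_]; rewrite ?muln0 // leq_mul2l uk orbT.
Qed.

Lemma subst_gen_series (T : choiceType) (A : set T) w u (y : I -> mfps I R) :
    finite_below w -> (forall i, (0 < u i i)%N) -> (forall i, y i = monoX (u i)) ->
  mfps_subst (gen_series A w) y = gen_series A (subst_monom u \o w).
Proof.
move=> fw u_gt0 yE; apply/mfpsP => n.
have prodE m : (\prod_(i <- finsupp m) y i ^+ m i) n = (n == subst_monom u m)%:R.
  by under eq_bigr do rewrite yE monoX_exp; rewrite monoX_prod.
rewrite /mfps_subst /=; under eq_fsbigr do rewrite prodE.
(* Only divisors of [n] can be sent to [n], so the sum over all monomials is finite. *)
rewrite (@fsbigTE _ _ _ _ (cm_divisors n)) => [|m nm]; last first.
  case: eqP => [ne|_]; last by rewrite mulr0.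
  case/negP: nm; apply/cm_divisorsP => i; rewrite ne; exact: leq_subst_monom.
rewrite (sum_gen_series A n (fun m => (n == subst_monom u m)%:R)) //.
apply/esym/gen_series_seq => [|t|t At /= tn]; first exact: fset_uniq.
  by case/(belowP _ _ _ fw).
apply/(belowP _ _ _ fw); split=> //; apply/cm_divisorsP => i.
by rewrite -tn leq_subst_monom.
Qed.

End Substitution.

(** * The weight monomial of a permutation and its behaviour under the constructions *)

Section Weight.
Local Open Scope classical_set_scope.

Definition weight (p : allperm) : {cmonom nat} :=
  \big[mmul/mone]_(k < tag p) expcmn (ucm (k : nat)) (incr_count k.+1 (tagged p)).

Lemma perm_weightE p : perm_weight p = monoX (weight p).
Proof. by rewrite /perm_weight -monoX_prod; apply: eq_bigr => k _; rewrite monoX_exp. Qed.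

Lemma weightE p k : weight p k = incr_count k.+1 (tagged p).
Proof.
rewrite /weight (big_morph (fun x : {cmonom nat} => x k) (cmM k) (cm1 k)).
have [kp|pk] := ltnP k (tag p).
  rewrite (bigD1 (Ordinal kp)) //= expcmnE cmUU muln1 big1 ?addn0 // => i ik.
  by rewrite expcmnE cmU (_ : (_ == _) = false) ?muln0 //; apply/negbTE.
rewrite incr_count_gt // big1 // => i _; rewrite expcmnE cmU.
by rewrite (_ : (_ == _) = false) ?muln0 // (ltn_eqF (leq_trans (ltn_ord i) pk)).
Qed.

(** The exponent of variable 0 is the length, and there are finitely many permutations of bounded
    length. *)
Lemma finite_below_weight : finite_below weight.
Proof.
move=> m; apply: (@sub_finite_set _ _ (\bigcup_(n in `I_(m 0).+1) range (@mkperm n))).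
  move=> [n s] /= /cm_divisorsP/(_ 0); rewrite weightE incr_count1 => nm.
  by exists n => //; exists s.
by apply: bigcup_finite => [|n _]; [exact: finite_II | exact/finite_image/finite_finset].
Qed.

Definition shift_var (k : nat) : {cmonom nat} := mmul (ucm k) (ucm k.+1).

Lemma subst_shift_var0 (m : {cmonom nat}) : subst_monom shift_var m 0 = m 0.
Proof.
rewrite subst_monomE -[RHS]finsupp_sum; apply: eq_bigr => i _.
by rewrite cmM !cmU addn0.
Qed.

Lemma subst_shift_varS (m : {cmonom nat}) k :
  subst_monom shift_var m k.+1 = (m k.+1 + m k)%N.
Proof.
rewrite subst_monomE -[in RHS]finsupp_sum -[X in (_ + X)%N]finsupp_sum -big_split /=.
by apply: eq_bigr => i _; rewrite cmM !cmU mulnDr eqSS.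
Qed.

Lemma subst_monomM u v (m : {cmonom nat}) :
  subst_monom (fun k => mmul (u k) (v k)) m = mmul (subst_monom u m) (subst_monom v m).
Proof.
apply/eqP/cmP => k; rewrite cmM !subst_monomE -big_split /=.
by apply: eq_bigr => i _; rewrite cmM mulnDr.
Qed.

(** The extra [ucm 0] is the empty subsequence, which the new maximum extends to one of length 1. *)
Lemma weight_grow p : weight (perm_grow p) = mmul (ucm 0) (subst_monom shift_var (weight p)).
Proof.
apply/eqP/cmP => -[|k]; rewrite cmM cmU weightE incr_count_grow.
  by rewrite subst_shift_var0 weightE incr_count0 addnC.
by rewrite subst_shift_varS !weightE.
Qed.

Lemma weight_swap q :
  weight (perm_swap q) =
  mmul (mmul (weight (perm_grow q.1)) (weight (perm_grow q.1))) (weight q.2).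
Proof.
apply/eqP/cmP => k; rewrite !cmM !weightE incr_count_swap.
by rewrite addnAC.
Qed.

End Weight.

(** * The functional equation *)

Local Open Scope ring_scope.

(** The three terms come from the three disjoint pieces of [I132_decomp]; injectivity of the
    constructions lets each image be summed over its source. *)
Lemma gen_series_I132 (R : comUnitRingType) :
  gen_series I132 weight =
    1 + gen_series I132 (weight \o perm_grow)
    + gen_series S132 (fun p => mmul (weight (perm_grow p)) (weight (perm_grow p)))
      * gen_series I132 weight :> mfps nat R.
Proof.
have fw := finite_below_weight.
have e0 : gen_series [set perm_nil]%classic weight = 1 :> mfps nat R.
  by rewrite gen_series_set1 /weight big_ord0.
have e1 : gen_series (perm_grow @` I132)%classic weight =
    gen_series I132 (weight \o perm_grow) :> mfps nat R.
  exact/gen_series_image/perm_grow_inj.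
have e2 : gen_series (perm_swap @` (S132 `*` I132))%classic weight =
    gen_series S132 (fun p => mmul (weight (perm_grow p)) (weight (perm_grow p)))
      * gen_series I132 weight :> mfps nat R.
  have fg : finite_below (fun p => mmul (weight (perm_grow p)) (weight (perm_grow p))).
    (* Appending a maximum loses no increasing subsequence, so exponents are at least those of
       [weight p]. *)
    apply: finite_below_le fw => p k; rewrite cmM !weightE incr_count_grow.
    by rewrite -addnA leq_addr.
  rewrite (gen_seriesM S132 I132 fg fw).
  by rewrite (gen_series_image _ _ perm_swap_inj) (eq_gen_series _ weight_swap).
have eU1 := gen_seriesU (R := R) fw perm_nil_notin.
have eU2 := gen_seriesU (R := R) fw (grow_swap_disjoint I132 (S132 `*` I132)%classic).
have eD := congr1 (fun A => gen_series A weight : mfps nat R) I132_decomp.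
rewrite -addrA; apply: (etrans eD); apply: (etrans eU1).
exact: (congr2 +%R e0 (etrans eU2 (congr2 +%R e1 e2))).
Qed.

Theorem theorem4p2 :
  C_I =
    (1 + varX 0%N * mfps_subst C_I (fun k : nat => varX k * varX k.+1))
    / (1 - varX 0%N ^+ 2 *
           mfps_subst C_S (fun k : nat => varX k ^+ 2 * varX k.+1 ^+ 2)).
Proof.
have fw := finite_below_weight.
have weight_sum A : mfps_sum A perm_weight = gen_series A weight.
  by congr mfps_sum; apply/funext => p; exact: perm_weightE.
pose sq k := mmul (shift_var k) (shift_var k).
have shift_gt0 k : (0 < shift_var k k)%N by rewrite cmM cmUU.
have sq_gt0 k : (0 < sq k k)%N by rewrite cmM addn_gt0 shift_gt0.
have fin_subst (u : nat -> {cmonom nat}) :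
    (forall k, (0 < u k k)%N) -> finite_below (subst_monom u \o weight).
  by move=> u_gt0; apply: finite_below_le fw => t i; exact: leq_subst_monom.
have yE i : varX i * varX i.+1 = monoX (shift_var i) :> mfps nat int by rewrite monoXM.
have y2E i : varX i ^+ 2 * varX i.+1 ^+ 2 = monoX (sq i) :> mfps nat int.
  by rewrite -exprMn yE expr2 -monoXM.
have x2E : varX 0%N ^+ 2 = monoX (mmul (ucm 0%N) (ucm 0%N)) :> mfps nat int.
  by rewrite expr2 -monoXM.
have grow_series : gen_series I132 (weight \o perm_grow) =
    varX 0%N * mfps_subst C_I (fun k : nat => varX k * varX k.+1).
  rewrite /C_I weight_sum (subst_gen_series I132 fw shift_gt0 yE).
  rewrite -(gen_series_shift _ _ (fin_subst _ shift_gt0)).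
  by apply: eq_gen_series => p; rewrite /= weight_grow.
(* The two outer layers have equal weight, so together they contribute a square, which amounts to
   substituting squared monomials into [C_S]. *)
have pair_series :
    gen_series S132 (fun p => mmul (weight (perm_grow p)) (weight (perm_grow p))) =
    varX 0%N ^+ 2 * mfps_subst C_S (fun k : nat => varX k ^+ 2 * varX k.+1 ^+ 2).
  rewrite /C_S weight_sum (subst_gen_series S132 fw sq_gt0 y2E) x2E.
  rewrite -(gen_series_shift _ _ (fin_subst _ sq_gt0)).
  apply: eq_gen_series => p; rewrite /= weight_grow (subst_monomM shift_var shift_var).
  by apply/eqP/cmP => k; rewrite !cmM addnACA.
rewrite -grow_series -pair_series.
set G := gen_series I132 _; set P := gen_series S132 _.
(* [P] is a multiple of the square of variable 0, so [1 - P] has constant coefficient 1. *)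
have unitP : 1 - P \is a GRing.unit.
  rewrite /P pair_series unit_1subM // x2E /=.
  case: eqP => // /(congr1 (fun m : {cmonom nat} => m 0%N)).
  by rewrite cm1 cmM cmUU.
(* Clearing the denominator turns the goal into [gen_series_I132]. *)
apply: (canRL (mulrK unitP)); rewrite mulrBr mulr1 mulrC.
by apply/eqP; rewrite subr_eq; apply/eqP; rewrite /C_I weight_sum; exact: gen_series_I132.
Qed.
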